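(* There is a function $f:\mathbb N\times\mathbb N\to\mathbb N$ such that the following holds: for all $d,k\in\mathbb N$ with $k\ge2$, every $n$, and every relation $R\subseteq\underline n^k$ with projected grid-rank at most $d$, the projection $\pi_{1,2}R=\{(x_1,x_2):\exists x\in R\text{ with first two coordinates }x_1,x_2\}\subseteq\underline n^2$ has grid-rank at most $f(d,k)$.
   Context: $\underline n=\{0,\dots,n-1\}$ with natural order. Grid-rank: for a binary relation $R'\subseteq P\times Q$ with $P,Q$ totally ordered finite sets, a $d$-division is a pair of partitions of $P$ and of $Q$ into $d$ consecutive intervals $I_1<\dots<I_d$, $J_1<\dots<J_d$; it has rank $k$ if in every cell $I_i\times J_j$ the restriction of $R'$ has at least $k$ distinct rows and at least $k$ distinct columns; $R'$ has grid-rank at least $k$ if it has a $k$-division of rank $k$, and the grid-rank is the largest such $k$. An ordered subset of $\underline n^A$ is a set $S$ with an ordering $s_1\prec\dots\prec s_m$ such that in every coordinate $j\in A$ the sequence $s_1[j],\dots,s_m[j]$ is strictly increasing, constant, or strictly decreasing. For $R\subseteq\underline n^k$ and a partition $\{1,\dots,k\}=A\cup B$, a projected grid of $R$ is $R'=\{(s,t)\in S\times T: s\cup t\in R\}$ where $S$ is an ordered subset of $\underline n^A$, $T$ of $\underline n^B$ (ordered by their orderings), and $s\cup t$ is the $k$-tuple agreeing with $s$ on $A$ and $t$ on $B$. The projected grid-rank of $R$ is the largest grid-rank of a projected grid of $R$. *)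

(* Defs.v *)
From mathcomp Require Import all_boot all_order.

Set Implicit Arguments.
Unset Strict Implicit.
Unset Printing Implicit Defensive.

(* Consecutiveness is not a separate clause: parts that cover [P] and satisfy
   [I_i < I_j] for [i < j] are disjoint and convex. *)
Definition interval_partition (dP : Order.disp_t) (d : nat) (P : finOrderType dP)
    (I : {ffun 'I_d -> {set P}}) : bool :=
  [&& [forall i, I i != set0],
      [forall x, exists i, x \in I i]
    & [forall i : 'I_d, forall j : 'I_d, (i < j) ==>
        [forall x in I i, forall y in I j, (x < y)%O]]].

Section Rank.

Context {dP dQ : Order.disp_t} {P : finOrderType dP} {Q : finOrderType dQ}.
Variable R : P -> Q -> bool.

(* A row of the restriction of [R] to [I * J] is identified with the subset of
   [J] it relates to, and likewise for columns. *)
Definition distinct_rows (I : {set P}) (J : {set Q}) : {set {set Q}} :=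
  [set [set y in J | R x y] | x in I].

Definition distinct_cols (I : {set P}) (J : {set Q}) : {set {set P}} :=
  [set [set x in I | R x y] | y in J].

Definition division_has_rank (d k : nat)
    (I : {ffun 'I_d -> {set P}}) (J : {ffun 'I_d -> {set Q}}) : bool :=
  [forall i, forall j, (k <= #|distinct_rows (I i) (J j)|)
                    && (k <= #|distinct_cols (I i) (J j)|)].

Definition grid_rank_atleast (k : nat) : bool :=
  [exists I : {ffun 'I_k -> {set P}}, exists J : {ffun 'I_k -> {set Q}},
    [&& interval_partition I, interval_partition J
      & division_has_rank k I J]].

(* The parts of a [k]-division are nonempty, so [k <= #|P|] (see
   [grid_rank_atleast_card]).  The rank is [0] if there is no division. *)
Definition grid_rank : nat :=
  \max_(k < #|P|.+1 | grid_rank_atleast k) k.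

End Rank.

Section ProjectedGrid.

Variables n k : nat.

(* The power of [{0, ..., n-1}] with exponent [A]. *)
Definition point (A : {set 'I_k}) := {ffun {i : 'I_k | i \in A} -> 'I_n}.

Definition restr (A : {set 'I_k}) (x : {ffun 'I_k -> 'I_n}) : point A :=
  [ffun a => x (val a)].

Definition strict_or_constant (s : seq 'I_n) : bool :=
  [|| sorted (fun a b : 'I_n => a < b) s,
      constant s
    | sorted (fun a b : 'I_n => b < a) s].

(* An ordered subset is given by the duplicate-free list of its elements, in
   the order it carries. *)
Definition ordered_subset (A : {set 'I_k}) (S : seq (point A)) : bool :=
  uniq S &&
  [forall j : {i : 'I_k | i \in A}, strict_or_constant [seq (s : point A) j | s <- S]].

(* As [~: A] is the complement of [A], exactly one [x] agrees with [s] on [A]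
   and with [t] on [~: A]. *)
Definition joined (R : {set {ffun 'I_k -> 'I_n}}) (A : {set 'I_k})
    (s : point A) (t : point (~: A)) : bool :=
  [exists x in R, (restr A x == s) && (restr (~: A) x == t)].

(* The rows and columns are indexed by the positions in [S] and [T], so that
   the order of ['I_p] is the one carried by [S], and that of ['I_q] the one
   carried by [T]. *)
Definition projected_grid (R : {set {ffun 'I_k -> 'I_n}}) (A : {set 'I_k})
    (p q : nat) (S : p.-tuple (point A)) (T : q.-tuple (point (~: A)))
    (i : 'I_p) (j : 'I_q) : bool :=
  joined R (tnth S i) (tnth T j).

(* The bounds on the sizes of [S] and [T] only make the range finite; see
   [projected_grid_rank_leP]. *)
Definition projected_grid_rank (R : {set {ffun 'I_k -> 'I_n}}) : nat :=
  \max_(A : {set 'I_k})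
  \max_(p < #|{: point A}|.+1) \max_(q < #|{: point (~: A)}|.+1)
  \max_(S : p.-tuple (point A) | ordered_subset S)
  \max_(T : q.-tuple (point (~: A)) | ordered_subset T)
    grid_rank (projected_grid R S T).

(* Coordinates are numbered from [0]: the first two are [0] and [1]. *)
Definition proj12 (hk : 1 < k) (R : {set {ffun 'I_k -> 'I_n}})
    (a b : 'I_n) : bool :=
  [exists x in R, (x (Ordinal (ltnW hk)) == a) && (x (Ordinal hk) == b)].

End ProjectedGrid.

Lemma interval_partition_card (dP : Order.disp_t) (P : finOrderType dP)
    (d : nat) (I : {ffun 'I_d -> {set P}}) :
  interval_partition I -> d <= #|P|.
Proof.
case/and3P=> /forallP I0 _ /forallP Ilt.
have Ix i : exists x, x \in I i by exact/set0Pn/I0.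
pose g i := xchoose (Ix i).
have gI i : g i \in I i by exact: xchooseP.
have glt (i j : 'I_d) : i < j -> (g i < g j)%O.
  move=> ij; move/forallP/(_ j)/implyP/(_ ij): (Ilt i).
  by move/forall_inP/(_ _ (gI i))/forall_inP/(_ _ (gI j)).
rewrite -[d in d <= _]card_ord; apply: (@leq_card _ _ g) => i j gij.
apply/val_inj; case: (ltngtP i j) => // /glt.
  by rewrite gij Order.POrderTheory.ltxx.
by rewrite gij Order.POrderTheory.ltxx.
Qed.

Lemma grid_rank_atleast_card (dP dQ : Order.disp_t) (P : finOrderType dP)
    (Q : finOrderType dQ) (R : P -> Q -> bool) (k : nat) :
  grid_rank_atleast R k -> k <= #|P|.
Proof.
by case/existsP=> I /existsP [J] /and3P [/interval_partition_card].
Qed.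

Lemma grid_rank_leP (dP dQ : Order.disp_t) (P : finOrderType dP)
    (Q : finOrderType dQ) (R : P -> Q -> bool) (d : nat) :
  grid_rank R <= d <-> (forall k, grid_rank_atleast R k -> k <= d).
Proof.
split=> [/bigmax_leqP H k Rk | H]; last by apply/bigmax_leqP => k; apply: H.
exact: (H (Ordinal (grid_rank_atleast_card Rk : k < #|P|.+1))).
Qed.

Lemma projected_grid_rank_leP (n k : nat) (R : {set {ffun 'I_k -> 'I_n}})
    (d : nat) :
  projected_grid_rank R <= d <->
  (forall (A : {set 'I_k}) (p q : nat)
          (S : p.-tuple (point n A)) (T : q.-tuple (point n (~: A))),
     ordered_subset S -> ordered_subset T ->
     grid_rank (projected_grid R S T) <= d).
Proof.
have sz (A : {set 'I_k}) p (S : p.-tuple (point n A)) :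
    ordered_subset S -> p < #|{: point n A}|.+1.
  case/andP=> /card_uniqP cS _.
  by rewrite ltnS -[p in p <= _](size_tuple S) -cS max_card.
split=> [/bigmax_leqP H A p q S T oS oT | H].
  move/bigmax_leqP: (H A isT) => /(_ (Ordinal (sz _ _ _ oS)) isT).
  move/bigmax_leqP => /(_ (Ordinal (sz _ _ _ oT)) isT).
  by move/bigmax_leqP => /(_ S oS) /bigmax_leqP /(_ T oT).
apply/bigmax_leqP => A _; apply/bigmax_leqP => p _; apply/bigmax_leqP => q _.
by apply/bigmax_leqP => S oS; apply/bigmax_leqP => T oT; exact: H.
Qed.

(* Main.v *)
Require Import Defs.
From mathcomp Require Import all_boot all_order.
From mathcomp Require Import zify.

(* Suppose that the projection M of R has huge grid-rank.  Each cell of the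
   division contains long sequences of rows and columns on which M is constant
   below the diagonal and takes the opposite value on it; choose for the pairs in
   M full tuples of R as witnesses.  Ramsey's theorem makes the witnesses of all
   cells canonical: for two witnesses from different cell rows and different cell
   columns, the comparison in each coordinate and the truth of the mixed tuples
   (coordinates in A from one, the others from the other) depend only on the
   order of the cell rows and of the cell columns.  So each coordinate follows
   either the cell rows (or is constant) or the cell columns, which gives the
   partition A, ~A.  Along a permutation of the cells, the A-parts and the
   ~A-parts of the witnesses are then ordered subsets, and their projected grid
   is given by a function e of two signs outside the permutation, and is true on
   it.  Shifting the witnesses of the columns makes it false on the permutation
   and leaves e unchanged, so a constant e can be assumed to differ from the
   value on the permutation.  For a universal permutation the grid then has large
   grid-rank. *)

Set Implicit Arguments.
Unset Strict Implicit.
Unset Printing Implicit Defensive.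

(** * Ramsey's theorem for subsequences of fixed length *)

Definition homogeneous (T : eqType) (C : Type) (c : seq T -> C) (r : nat)
    (col : C) (t : seq T) : Prop :=
  forall q, subseq q t -> size q = r -> c q = col.

(** Targets that vary with the colour allow induction on their sum. The head [x] colours the
    [r]-subsequences of the rest; on a homogeneous tail of colour [col] the target of [col] drops by
    one, since [x] can be put back in front. *)
Lemma ramsey_weighted (C : finType) (r : nat) :
  (forall m, {N | forall (T : eqType) (c : seq T -> C) s, N <= size s ->
     exists t col, [/\ subseq t s, m <= size t & homogeneous c r col t]}) ->
  forall w, {N | forall (mu : C -> nat), \sum_col mu col <= w ->
    forall (T : eqType) (c : seq T -> C) s, N <= size s ->
     exists t col,
       [/\ subseq t s, mu col <= size t & homogeneous c r.+1 col t]}.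
Proof.
move=> IHr; have nilh (T : eqType) (c : seq T -> C) col :
    homogeneous c r.+1 col [::] by move=> q; rewrite subseq0 => /eqP->.
elim=> [|w [N IHw]].
  exists 0 => mu mu0 T c s _; exists [::], (c s); split=> //=; first exact: sub0seq.
  by move: mu0; rewrite leqn0 sum_nat_eq0 => /forall_inP/(_ (c s) isT)/eqP->.
have [N' IHr'] := IHr N; exists N'.+1 => mu muw T c [//|x s] /= sN.
have [t [col [ts tN th]]] := IHr' T (fun q => c (x :: q)) s sN.
have [mu0|mu_gt0] := posnP (mu col).
  by exists [::], col; split; rewrite ?mu0 ?sub0seq.
pose mu' d := mu d - (d == col).
have mu'w : \sum_d mu' d <= w.
  rewrite -ltnS; apply: leq_trans muw.
  rewrite (bigD1 col) //= [X in _ < X](bigD1 col) //= /mu' eqxx subn1.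
  rewrite -addSn prednK // leq_add2l leq_sum // => d _; exact: leq_subr.
have [t' [col' [t't t'N t'h]]] := IHw mu' mu'w T c t tN.
have t's := subseq_trans t't ts.
have [eq_col|ne_col] := eqVneq col' col; last first.
  exists t', col'; split=> //; first exact: subseq_trans t's (subseq_cons s x).
  by move: t'N; rewrite /mu' (negPf ne_col) subn0.
exists (x :: t'), col; split; first by rewrite /= eqxx.
  by move: t'N; rewrite /mu' eq_col eqxx /=; lia.
case=> [//|y q] /=; have [->|_] := eqVneq y x.
  by move=> qt' [sq]; apply: th => //; apply: subseq_trans t't.
by move=> qt' sq; rewrite -eq_col; apply: t'h.
Qed.

Lemma ramsey (C : finType) (r m : nat) :
  {N | forall (T : eqType) (c : seq T -> C) s, N <= size s ->
    exists t col, [/\ subseq t s, m <= size t & homogeneous c r col t]}.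
Proof.
elim: r m => [|r IHr] m.
  by exists m => T c s ms; exists s, (c [::]); split=> // q _ /size0nil->.
have [N HN] := ramsey_weighted IHr (\sum_(col : C) m).
by exists N => T c s sN; apply: HN (fun=> m) (leqnn _) T c s sN.
Qed.

Lemma subseq_nth_sorted (s : seq nat) (q : seq nat) :
  sorted ltn q -> all (gtn (size s)) q -> subseq [seq nth 0 s i | i <- q] s.
Proof.
move=> sq aq; rewrite -[X in subseq _ X](mkseq_nth 0) /mkseq map_subseq //.
have -> : q = [seq i <- iota 0 (size s) | i \in q].
  apply: (irr_sorted_eq ltn_trans ltnn) => //.
    by rewrite sorted_filter ?iota_ltn_sorted //; apply: ltn_trans.
  move=> i; rewrite mem_filter mem_iota add0n leq0n /=.
  by case: (boolP (i \in q)) => // /(allP aq) /= ->.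
exact: filter_subseq.
Qed.

(** * Distinct rows and columns of a cell *)

Section Rows.
Context {dP dQ : Order.disp_t} {P : finOrderType dP} {Q : finOrderType dQ}.
Variable M : P -> Q -> bool.

Lemma distinct_rows_splitter (X : {set P}) (J : {set Q}) :
  1 < #|distinct_rows M X J| ->
  exists x1 x0 y, [/\ x1 \in X, x0 \in X, y \in J, M x1 y & ~~ M x0 y].
Proof.
case/card_gt1P=> _ [_ [/imsetP[x xX ->] /imsetP[x' x'X ->]]].
case: (pickP (fun y => (y \in J) && (M x y != M x' y))) => [y /andP[yJ] | eqxx'].
  case E: (M x y); case E': (M x' y) => // _ _.
    by exists x, x', y; rewrite E' E.
  by exists x', x, y; rewrite E' E.
case/eqP; apply/setP=> y; rewrite !inE; move: (eqxx' y).
by case: (y \in J) => //= /negbFE/eqP.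
Qed.

(** Some column splits the rows into two classes, one of which keeps half of the distinct rows. The
    next row comes from the other class, and the search continues in the rich one. *)
Lemma greedy_rows (x0 : P) (y0 : Q) (J : {set Q}) t (X : {set P}) :
  2 ^ t <= #|distinct_rows M X J| ->
  exists (x : nat -> P) (y : nat -> Q) (c : nat -> bool),
    (forall v, v < t -> [/\ x v \in X, y v \in J & M (x v) (y v) = ~~ c v]) /\
    (forall v u, v < u < t -> M (x u) (y v) = c v).
Proof.
elim: t X => [|t IH] X Xt.
  by exists (fun=> x0), (fun=> y0), (fun=> true); split=> // v u; rewrite ltn0 andbF.
have X1 : 1 < #|distinct_rows M X J|.
  by apply: leq_trans Xt; rewrite expnS -{1}[2]muln1 leq_mul2l expn_gt0.
have [x1 [x2 [y [x1X x2X yJ M1 M2]]]] := distinct_rows_splitter X1.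
pose Y b := [set x in X | M x y == b].
have eqX0 : Y true :|: Y false = X.
  by apply/setP=> x; rewrite !inE; case: (x \in X); case: (M x y).
have eqX : distinct_rows M X J =
    distinct_rows M (Y true) J :|: distinct_rows M (Y false) J.
  by rewrite /distinct_rows -imsetU eqX0.
have [b Yb] : exists b, 2 ^ t <= #|distinct_rows M (Y b) J|.
  case: (leqP (2 ^ t) #|distinct_rows M (Y true) J|) => [|lt1]; first by exists true.
  exists false; move: Xt; rewrite eqX expnS => Xt.
  have := leq_trans Xt (leq_card_setU _ _); lia.
have [x [y' [c [H1 H2]]]] := IH _ Yb.
pose x' := if b then x2 else x1.
exists (fun v => if v is v'.+1 then x v' else x').
exists (fun v => if v is v'.+1 then y' v' else y).
exists (fun v => if v is v'.+1 then c v' else b); split.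
  case=> [_ | v vt] /=.
    by split=> //; rewrite /x'; case: (b) => //; rewrite (negPf M2).
  by have [] := H1 v vt; rewrite inE => /andP[].
case=> [|v] [|u] //= vu; last exact: H2.
by have [] := H1 u vu; rewrite inE => /andP[_ /eqP].
Qed.

Lemma distinct_lines (I : {set P}) (J : {set Q}) (s : nat)
    (r : 'I_s -> P) (c : 'I_s -> Q) :
  (forall u, r u \in I) -> (forall v, c v \in J) ->
  (forall u u' : 'I_s, u < u' -> exists v, M (r u) (c v) != M (r u') (c v)) ->
  (forall v v' : 'I_s, v < v' -> exists u, M (r u) (c v) != M (r u) (c v')) ->
  s <= #|distinct_rows M I J| /\ s <= #|distinct_cols M I J|.
Proof.
move=> rI cJ Hr Hc; split.
  pose g u := [set y in J | M (r u) y].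
  have gi : injective g.
    have g_lt (u u' : 'I_s) : u < u' -> g u <> g u'.
      move=> /Hr [v /eqP ne]; rewrite /g => /setP/(_ (c v)); rewrite !inE cJ; exact: ne.
    move=> u u' guu'; apply/val_inj; case: (ltngtP u u') => // /g_lt; first by [].
    by rewrite guu'.
  rewrite -[s in s <= _]card_ord -(card_imset predT gi).
  by apply/subset_leq_card/subsetP=> _ /imsetP[u _ ->]; apply: imset_f.
pose g v := [set x in I | M x (c v)].
have gi : injective g.
  have g_lt (v v' : 'I_s) : v < v' -> g v <> g v'.
    move=> /Hc [u /eqP ne]; rewrite /g => /setP/(_ (r u)); rewrite !inE rI; exact: ne.
  move=> u u' guu'; apply/val_inj; case: (ltngtP u u') => // /g_lt; first by [].
  by rewrite guu'.
rewrite -[s in s <= _]card_ord -(card_imset predT gi).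
by apply/subset_leq_card/subsetP=> _ /imsetP[u _ ->]; apply: imset_f.
Qed.
End Rows.

(** * A universal permutation and its grid *)

Lemma ord_pair_subproof n (a b : 'I_n) : a * n + b < n * n.
Proof. by have := ltn_ord a; have := ltn_ord b; nia. Qed.

Definition ord_pair n (a b : 'I_n) : 'I_(n * n) := Ordinal (ord_pair_subproof a b).

Lemma digit_swap_subproof n (x : 'I_(n * n)) : x %% n * n + x %/ n < n * n.
Proof.
have n_gt0 : 0 < n by case: n x => // -[].
have := ltn_pmod x n_gt0.
have : x %/ n < n by rewrite ltn_divLR.
nia.
Qed.

(** The graph of this permutation has exactly one point in each product of two blocks of length
    [n]. *)
Definition digit_swap n (x : 'I_(n * n)) : 'I_(n * n) :=
  Ordinal (digit_swap_subproof x).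

Lemma ord_pair_div n (a b : 'I_n) : ord_pair a b %/ n = a.
Proof.
have n_gt0 : 0 < n by apply: leq_trans (ltn_ord a).
by rewrite /= divnMDl // divn_small ?addn0.
Qed.

Lemma ord_pair_mod n (a b : 'I_n) : ord_pair a b %% n = b.
Proof. by rewrite /= modnMDl modn_small. Qed.

Lemma digit_swap_pair n (a b : 'I_n) : digit_swap (ord_pair a b) = ord_pair b a.
Proof. by apply/val_inj; rewrite [LHS]/= ord_pair_div ord_pair_mod. Qed.

Lemma digit_swapK n : involutive (@digit_swap n).
Proof.
move=> x; apply/val_inj => /=.
have n_gt0 : 0 < n by case: n x => // -[].
have xn : x %/ n < n by rewrite ltn_divLR.
by rewrite modnMDl divnMDl // (modn_small xn) (divn_small xn) addn0 -divn_eq.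
Qed.

Definition div_blocks m k b : {ffun 'I_k -> {set 'I_m}} :=
  [ffun A : 'I_k => [set x : 'I_m | x %/ b == A]].

Lemma div_blocks_partition m k b :
  0 < b -> m = k * b -> interval_partition (div_blocks m k b).
Proof.
move=> b0 mk; apply/and3P; split.
- apply/forallP=> A; apply/set0Pn.
  have Am : A * b < m by rewrite mk ltn_pmul2r.
  by exists (Ordinal Am); rewrite ffunE inE /= mulnK.
- apply/forallP=> x; apply/existsP.
  have xk : x %/ b < k by rewrite ltn_divLR // -mk.
  by exists (Ordinal xk); rewrite ffunE inE.
apply/forallP=> A; apply/forallP=> B; apply/implyP=> AB.
apply/forall_inP=> x; rewrite ffunE inE => /eqP xA.
apply/forall_inP=> y; rewrite ffunE inE => /eqP yB.
rewrite Order.OrdinalOrder.ltEord ltnNge; apply: contraTN AB => yx.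
by rewrite -leqNgt -xA -yB leq_div2r.
Qed.

(* The points [(x, digit_swap x)] form a permutation pattern with [k ^ 2] points
   in each of the [k ^ 2] cells.  If [e] depends on one of its arguments, then
   fixing the other one yields a half-graph in each cell; otherwise
   [~~ e true true] on the permutation yields a matching or its complement. *)
Lemma digit_swap_grid_rank k (E : 'I_(k * k * (k * k)) -> 'I_(k * k * (k * k)) -> bool)
    (e : bool -> bool -> bool) :
  1 < k ->
  (forall x, E x (digit_swap x) = ~~ e true true) ->
  (forall x y, y != digit_swap x ->
     E x y = e (x < digit_swap y) (digit_swap x < y)) ->
  grid_rank_atleast E k.
Proof.
move=> k1 Eeq Ene; set K := k * k in E Eeq Ene *.
have K0 : 0 < K by rewrite /K; nia.
pose k0 : 'I_k := Ordinal (ltnW k1); pose k'1 : 'I_k := Ordinal k1.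
pose I := div_blocks (K * K) k (K * k).
have Ipart : interval_partition I.
  apply: div_blocks_partition; first by rewrite muln_gt0 K0 ltnW.
  by rewrite mulnA mulnAC.
apply/existsP; exists I; apply/existsP; exists I; rewrite Ipart /=.
apply/forallP=> A; apply/forallP=> B; apply/andP.
(* In base [k], [z u v] has the digits [A], [u], [B], [v] and its swap [B], [v], [A], [u]. So
   positions are ordered lexicographically by [(u, v)], their swaps by [(v, u)]. *)
pose z (u v : 'I_k) := ord_pair (ord_pair A u) (ord_pair B v).
have zI u v : z u v \in I A.
  by rewrite ffunE inE divnMA ord_pair_div ord_pair_div.
have zJ u v : digit_swap (z u v) \in I B.
  by rewrite digit_swap_pair ffunE inE divnMA ord_pair_div ord_pair_div.
have z_lt u v u' v' : (z u v < z u' v') = (u < u') || (u == u' :> nat) && (v < v').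
  rewrite /z /=; have := ltn_ord u; have := ltn_ord v; have := ltn_ord u'.
  have := ltn_ord v'; have := ltn_ord A; have := ltn_ord B; rewrite /K.
  have [uu'|uu'|->] /= := ltngtP u u'; try nia.
have s_lt u v u' v' : (digit_swap (z u v) < digit_swap (z u' v')) =
    (v < v') || (v == v' :> nat) && (u < u').
  rewrite !digit_swap_pair /=; have := ltn_ord u; have := ltn_ord v.
  have := ltn_ord u'; have := ltn_ord v'; have := ltn_ord A; have := ltn_ord B.
  rewrite /K; have [vv'|vv'|->] /= := ltngtP v v'; try nia.
have Ez (u v u' v' : 'I_k) : (u != u' :> nat) || (v != v' :> nat) ->
    E (z u v) (digit_swap (z u' v')) =
    e ((u < u') || (u == u' :> nat) && (v < v'))
      ((v < v') || (v == v' :> nat) && (u < u')).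
  move=> ne; rewrite Ene ?digit_swapK ?z_lt ?s_lt //.
  rewrite (can_eq (@digit_swapK K)); apply: contraL ne => /eqP eqz.
  have := z_lt u v u' v'; have := z_lt u' v' u v.
  rewrite eqz ltnn => /esym + /esym; lia.
(* As [k0 < k'1], the first argument of [e] is fixed at [true], and the second is [u <= v]. *)
have [e1|e1] := eqVneq (e true true) (e true false); last first.
  apply: (@distinct_lines _ _ _ _ E (I A) (I B) k (z k0)
    (fun v => digit_swap (z k'1 v))) => // u v uv.
    exists u; rewrite !Ez //= ltnn eqxx /= (ltnNge v u) (ltnW uv) /=.
    by rewrite (gtn_eqF uv).
  exists v; rewrite !Ez //= ltnn eqxx /= eq_sym; move: e1.
  by rewrite (ltnNge v u) (ltnW uv) /= (gtn_eqF uv).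
have [e2|e2] := eqVneq (e true true) (e false true); last first.
  apply: (@distinct_lines _ _ _ _ E (I A) (I B) k (z^~ k0)
    (fun v => digit_swap (z v k'1))) => // u v uv.
    exists u; rewrite !Ez ?orbT //= ltnn eqxx /= (ltnNge v u) (ltnW uv) /=.
    by rewrite (gtn_eqF uv).
  exists v; rewrite !Ez ?orbT //= ltnn eqxx /= eq_sym; move: e2.
  by rewrite (ltnNge v u) (ltnW uv) /= (gtn_eqF uv).
(* Exchanging [k0] and [k'1] fixes the second argument at [false]. *)
have [e3|e3] := eqVneq (e true true) (e false false); last first.
  apply: (@distinct_lines _ _ _ _ E (I A) (I B) k (z^~ k'1)
    (fun v => digit_swap (z v k0))) => // u v uv.
    by exists v; rewrite !Ez ?orbT //= ltnn eqxx /= uv -e1.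
  by exists u; rewrite !Ez ?orbT //= ltnn eqxx /= uv -e1 eq_sym.
have eC b b' : e b b' = e true true by case: b; case: b'.
apply: (@distinct_lines _ _ _ _ E (I A) (I B) k (z k0)
    (fun v => digit_swap (z k0 v))) => // u v uv; exists u.
  rewrite Eeq Ez; last by rewrite (gtn_eqF uv) orbT.
  by rewrite [X in _ != X]eC; case: (e true true).
rewrite Eeq Ez; last by rewrite (ltn_eqF uv) orbT.
by rewrite [X in _ != X]eC; case: (e true true).
Qed.

(** * Canonical witnesses for the cells *)

Lemma interval_partition_lt (dP : Order.disp_t) (P : finOrderType dP) d
    (I : {ffun 'I_d -> {set P}}) (i j : 'I_d) x y :
  interval_partition I -> i < j -> x \in I i -> y \in I j -> (x < y)%O.
Proof.
case/and3P=> _ _ /forallP/(_ i)/forallP/(_ j)/implyP Iij ij xI yJ.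
by move/forall_inP/(_ x xI)/forall_inP/(_ y yJ): (Iij ij).
Qed.

Section Families.
Variables (n k : nat) (hk : 1 < k).
Notation V := {ffun 'I_k -> 'I_n}.
Implicit Type R : {set V}.
Let i0 : 'I_k := Ordinal (ltnW hk).
Let i1 : 'I_k := Ordinal hk.

(* The greedy sequences satisfy [M (x v) (y v) = ~~ c v] and [M (x u) (y v) = c v]
   for [v < u]; [F u u'] is a witness in [R] of the pair [(x u, y u)] if [c u] is
   false, and of [(x u', y u)] otherwise. *)
Lemma cell_family R (I J : {set 'I_n}) t (a : 'I_n) :
  2 ^ t <= #|distinct_rows (proj12 hk R) I J| ->
  exists (F : nat -> nat -> V) (c : nat -> bool),
  [/\ forall u u', u < u' -> u' < t ->
        [/\ F u u' \in R, F u u' i0 \in I & F u u' i1 \in J],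
      forall u0 u1 u2, u0 < u1 -> u1 < u2 -> u2 < t -> ~~ c u0 -> ~~ c u1 ->
        ~~ proj12 hk R (F u1 u2 i0) (F u0 u1 i1)
    & forall u1 u2 u3, u1 < u2 -> u2 < u3 -> u3 < t -> c u1 -> c u2 ->
        ~~ proj12 hk R (F u1 u2 i0) (F u2 u3 i1)].
Proof.
move=> /(greedy_rows a a) [x [y [c [Hd Hu]]]].
pose X u u' := if c u then x u' else x u.
pose F u u' : V := odflt [ffun=> a]
  [pick f in R | (f i0 == X u u') && (f i1 == y u)].
have FP u u' : u < u' -> u' < t ->
    [/\ F u u' \in R, F u u' i0 = X u u' & F u u' i1 = y u].
  move=> uu' u't; rewrite /F; case: pickP => [f /and3P[fR /eqP-> /eqP->] // | none].
  have : proj12 hk R (X u u') (y u).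
    rewrite /X; case Ec: (c u); first by rewrite Hu ?uu'.
    by have [|_ _ ->] := Hd u; [exact: ltn_trans u't | rewrite Ec].
  by case/existsP=> f; rewrite none.
exists F, c; split=> [u u' uu' u't | u0 u1 u2 u01 u12 u2t c0 c1 | u1 u2 u3 u12 u23 u3t c1 c2].
- have [-> -> ->] := FP u u' uu' u't; rewrite /X.
  have [xu yu _] := Hd u (ltn_trans uu' u't); have [xu' _ _] := Hd u' u't.
  by case: (c u).
(* Here the pair is [(x u1, y u0)], with value [c u0]; in the last case it is [(x u2, y u2)], with
   value [~~ c u2]. *)
- have [_ -> _] := FP u1 u2 u12 u2t; have [_ _ ->] := FP u0 u1 u01 (ltn_trans u12 u2t).
  by rewrite /X (negPf c1) Hu // u01 (ltn_trans u12).
have [_ -> _] := FP u1 u2 u12 (ltn_trans u23 u3t); have [_ _ ->] := FP u2 u3 u23 u3t.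
by rewrite /X c1; have [_ _ ->] := Hd u2 (ltn_trans u23 u3t); rewrite c2.
Qed.

(** Every set [A] is recorded, because the partition of the coordinates is read off only from the
    homogeneous colour. *)
Definition pair_type R (p q : V) :
    {ffun 'I_k -> bool * bool} * {ffun {set 'I_k} -> bool * bool} :=
  ([ffun l => (p l < q l, q l < p l)],
   [ffun A => (joined R (restr A p) (restr (~: A) q),
               joined R (restr A q) (restr (~: A) p))]).

End Families.

(* The row index [a] stands for a cell interval together with positions
   [u0 < u1 < u2 < u3] in the greedy sequences of its cells.  The point
   [X true a b] is [F u1 u2], and [X false a b] is [F u0 u1] or [F u2 u3]
   according to the constant value of [c]: shifting the positions turns a
   witness into a non-edge of the projection without changing its order type
   relative to the points of other rows. *)
Lemma canonical_array k m : {N | forall n (hk : 1 < k)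
    (R : {set {ffun 'I_k -> 'I_n}}) K, N <= K ->
  grid_rank_atleast (proj12 hk R) K ->
  exists (X : bool -> 'I_m -> 'I_m -> {ffun 'I_k -> 'I_n}) D1 D2,
  [/\ forall a b, X true a b \in R,
      forall a b, ~~ proj12 hk R (X true a b (Ordinal (ltnW hk)))
                                 (X false a b (Ordinal hk)),
      forall (a a' b b' : 'I_m), a < a' ->
        X true a b (Ordinal (ltnW hk)) < X true a' b' (Ordinal (ltnW hk)),
      forall (a a' b b' : 'I_m), b < b' ->
        X true a b (Ordinal hk) < X true a' b' (Ordinal hk)
    & forall e e' (a a' b b' : 'I_m), a < a' -> b != b' ->
        pair_type R (X e a b) (X e' a' b') = if b < b' then D1 else D2]}.
Proof.
pose DT := ({ffun 'I_k -> bool * bool} * {ffun {set 'I_k} -> bool * bool})%type.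
(* Eight entries: two cell rows with two positions each, and two cell columns. The length gives each
   of [m] row indices five entries (a cell row and four positions) and each of [m] column indices
   one, with six to spare. *)
have [N HN] := ramsey (bool * DT * DT)%type 8 (6 * m.+1).
exists (2 ^ N) => n hk R [|K] NK; first by rewrite leqNgt expn_gt0 in NK.
case/existsP=> I /existsP[J /and3P[Ipart Jpart /forallP rk]].
set i0 := Ordinal (ltnW hk); set i1 := Ordinal hk.
have [a _] : exists a, a \in I ord0 by case/and3P: Ipart => /forallP/(_ ord0)/set0Pn.
have cells (ij : 'I_K.+1 * 'I_K.+1) :
  exists Fc : (nat -> nat -> {ffun 'I_k -> 'I_n}) * (nat -> bool),
      [/\ forall u u', u < u' -> u' < N ->
        [/\ Fc.1 u u' \in R, Fc.1 u u' i0 \in I ij.1 & Fc.1 u u' i1 \in J ij.2],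
      forall u0 u1 u2, u0 < u1 -> u1 < u2 -> u2 < N ->
        ~~ Fc.2 u0 -> ~~ Fc.2 u1 ->
        ~~ proj12 hk R (Fc.1 u1 u2 i0) (Fc.1 u0 u1 i1)
    & forall u1 u2 u3, u1 < u2 -> u2 < u3 -> u3 < N ->
        Fc.2 u1 -> Fc.2 u2 ->
        ~~ proj12 hk R (Fc.1 u1 u2 i0) (Fc.1 u2 u3 i1)].
  have /andP[rkij _] := forallP (rk ij.1) ij.2.
  have [F [c FcP]] := cell_family a (leq_trans NK rkij).
  by exists (F, c).
have {cells rk} [Fc FcP] := fin_all_exists cells.
pose G i j u u' := (Fc (inord i, inord j)).1 u u'.
pose g i j u := (Fc (inord i, inord j)).2 u.
(* Entries serve both as cell indices and as greedy positions; the two cell columns are taken in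
   both orders. *)
pose color (t : seq nat) : bool * DT * DT :=
  let s i := nth 0 t i in
  (g (s 0) (s 6) (s 1),
   pair_type R (G (s 0) (s 6) (s 1) (s 2)) (G (s 3) (s 7) (s 4) (s 5)),
   pair_type R (G (s 0) (s 7) (s 1) (s 2)) (G (s 3) (s 6) (s 4) (s 5))).
have [|t [[[c0 D1] D2] [tN tm th]]] := HN nat color (iota 0 N).
  by rewrite size_iota.
pose h i := nth 0 t i.
have t_sorted : sorted ltn t.
  by apply: (subseq_sorted ltn_trans tN); apply: iota_ltn_sorted.
have h_lt i j : i < j -> j < 6 * m.+1 -> h i < h j.
  move=> ij jm; apply: (sorted_ltn_nth ltn_trans) => //; rewrite inE; apply: leq_trans tm; lia.
have hN i : i < 6 * m.+1 -> h i < N.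
  move=> im; have : h i \in iota 0 N.
    by apply: (mem_subseq tN); apply: mem_nth; apply: leq_trans tm.
  by rewrite mem_iota.
have NK' : N <= K.+1 by apply: leq_trans NK; apply/ltnW/ltn_expl.
have col_h a0 a1 a2 a3 a4 a5 a6 a7 :
    sorted ltn [:: a0; a1; a2; a3; a4; a5; a6; a7] -> a7 < 6 * m.+1 ->
    color [seq h i | i <- [:: a0; a1; a2; a3; a4; a5; a6; a7]] = (c0, D1, D2).
  move=> sa a7m; apply: th; last by rewrite size_map.
  apply: subseq_nth_sorted => //; apply: (@sub_all _ (gtn (6 * m.+1))).
    by move=> z zm; apply: leq_trans tm.
  by move: sa => /=; lia.
pose X0 e a b := G (h (5 * a)) (h (5 * m.+1 + b)) (h (5 * a + e.+1)) (h (5 * a + e.+2)).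
have X0c e (a1 b1 : 'I_m) : e <= 2 ->
    g (h (5 * a1)) (h (5 * m.+1 + b1)) (h (5 * a1 + e.+1)) = c0.
  move=> e2; have a1m := ltn_ord a1; have b1m := ltn_ord b1.
  (* Spare entries stand in for the second cell row and the second cell column. *)
  have := @col_h (5 * a1) (5 * a1 + e.+1) (5 * a1 + e.+2) (5 * m)
    (5 * m).+1 (5 * m).+2 (5 * m.+1 + b1) (5 * m.+1 + m).
  by rewrite /= => H; case: (H ltac:(lia) ltac:(lia)).
have X0t e e' (a1 a2 b1 b2 : 'I_m) : e <= 2 -> e' <= 2 -> a1 < a2 -> b1 != b2 ->
    pair_type R (X0 e a1 b1) (X0 e' a2 b2) = if b1 < b2 then D1 else D2.
  move=> e2 e'2 a12 b12.
  have am := ltn_ord a2; have b1m := ltn_ord b1; have b2m := ltn_ord b2.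
  have := @col_h (5 * a1) (5 * a1 + e.+1) (5 * a1 + e.+2)
    (5 * a2) (5 * a2 + e'.+1) (5 * a2 + e'.+2).
  case: (ltngtP b1 b2) => [lt_b|lt_b|/val_inj eq_b]; last by rewrite eq_b eqxx in b12.
    move=> /(_ (5 * m.+1 + b1) (5 * m.+1 + b2)) /= H.
    by case: (H ltac:(lia) ltac:(lia)) => _ <- _.
  move=> /(_ (5 * m.+1 + b2) (5 * m.+1 + b1)) /= H.
  by case: (H ltac:(lia) ltac:(lia)) => _ _ <-.
have ordh i : i < 6 * m.+1 -> (inord (h i) : 'I_K.+1) = h i :> nat.
  by move=> im; rewrite inordK // (leq_trans (hN _ im)).
have X0P e (a1 b1 : 'I_m) : e <= 2 ->
    [/\ X0 e a1 b1 \in R, X0 e a1 b1 i0 \in I (inord (h (5 * a1)))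
      & X0 e a1 b1 i1 \in J (inord (h (5 * m.+1 + b1)))].
  move=> e2; have a1m := ltn_ord a1.
  have [FP _ _] := FcP (inord (h (5 * a1)), inord (h (5 * m.+1 + b1))).
  by apply: FP; [apply: h_lt | apply: hN]; lia.
pose E (e : bool) := if e then 1 else if c0 then 2 else 0.
have E2 e : E e <= 2 by rewrite /E; case: e; case: (c0).
exists (fun e a b => X0 (E e) a b), D1, D2; split.
- by move=> a1 b1; have [] := X0P _ a1 b1 (E2 true).
- move=> a1 b1; have a1m := ltn_ord a1.
  have [_ F0 F1] := FcP (inord (h (5 * a1)), inord (h (5 * m.+1 + b1))).
  have gc e : e <= 2 -> (Fc _).2 _ = c0 := @X0c e a1 b1.
  rewrite /E; case: (boolP c0) => c0b.
    by apply: F1; rewrite ?gc //; try apply: h_lt; try apply: hN; lia.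
  by apply: F0; rewrite ?gc //; try apply: h_lt; try apply: hN; lia.
- move=> a1 a2 b1 b2 a12; have a2m := ltn_ord a2.
  have [_ X1 _] := X0P _ a1 b1 (E2 true); have [_ X2 _] := X0P _ a2 b2 (E2 true).
  have := interval_partition_lt Ipart _ X1 X2.
  by apply; rewrite !ordh; try apply: h_lt; lia.
- move=> a1 a2 b1 b2 b12; have b2m := ltn_ord b2.
  have [_ _ X1] := X0P _ a1 b1 (E2 true); have [_ _ X2] := X0P _ a2 b2 (E2 true).
  have := interval_partition_lt Jpart _ X1 X2.
  by apply; rewrite !ordh; try apply: h_lt; lia.
by move=> e e' a1 a2 b1 b2; apply: X0t.
Qed.

(** * Ordered subsets and the conclusion *)

Lemma sorted_map_enum_ord (T : Type) (e : rel T) m (f : 'I_m -> T) :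
  (forall a b : 'I_m, a < b -> e (f a) (f b)) ->
  sorted e [seq f a | a <- enum 'I_m].
Proof.
move=> ef; rewrite sorted_map; apply: (@sub_sorted _ (fun a b : 'I_m => a < b)) => //.
by rewrite -(@sorted_map _ _ (@nat_of_ord m) ltn) val_enum_ord iota_ltn_sorted.
Qed.

(** A common order type makes each coordinate monotone; the strictly increasing [j0] rules out
    repetitions. *)
Lemma ordered_subset_mktuple n k (A : {set 'I_k}) m (f : 'I_m -> point n A)
    (c : {i : 'I_k | i \in A} -> bool * bool) (j0 : {i : 'I_k | i \in A}) :
  (forall (a b : 'I_m) j, a < b -> (f a j < f b j, f b j < f a j) = c j) ->
  c j0 = (true, false) ->
  ordered_subset [tuple f a | a < m].
Proof.
move=> fc cj0; have -> : val [tuple f a | a < m] = [seq f a | a <- enum 'I_m].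
  by rewrite /= enumT.
apply/andP; split.
  rewrite map_inj_uniq ?enum_uniq // => a b eqf; apply/val_inj.
  case: (ltngtP a b) => // lt_ab; have := fc _ _ j0 lt_ab.
    by rewrite eqf ltnn cj0.
  by rewrite eqf ltnn cj0.
apply/forallP=> j; rewrite -map_comp /strict_or_constant.
case E: (c j) => [[] c2].
- apply/or3P; apply: Or31; apply: sorted_map_enum_ord => a b ab /=.
  by have := fc _ _ j ab; rewrite E => -[->].
- case: c2 E => E; apply/or3P; [apply: Or33 | apply: Or32].
    apply: sorted_map_enum_ord => a b ab /=.
    by have := fc _ _ j ab; rewrite E => -[_ ->].
  have eq_f (a b : 'I_m) : f a j = f b j.
    apply/val_inj; wlog ab : a b / a < b => [hw | ].
      by case: (ltngtP a b) => [/hw | /hw | /val_inj->].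
    by have := fc _ _ j ab; rewrite E; case: ltngtP.
  case: (enum 'I_m) => //= a s; apply/allP=> _ /mapP[b _ ->] /=.
  by rewrite (eq_f b a).
Qed.

Theorem mainTheorem20 :
  exists f : nat -> nat -> nat,
    forall (d k : nat) (hk : 1 < k) (n : nat)
           (R : {set {ffun 'I_k -> 'I_n}}),
      projected_grid_rank R <= d ->
      grid_rank (proj12 hk R) <= f d k.
Proof.
(* The permutation on [d.+2 ^ 4] points yields grid-rank [d.+2], which exceeds [d] and is at least
   2, as [digit_swap_grid_rank] requires. *)
exists (fun d k => sval (canonical_array k (d.+2 * d.+2 * (d.+2 * d.+2)))).
move=> d k hk n R /projected_grid_rank_leP Rd; apply/grid_rank_leP => K HK.
case: canonical_array => N /= HN; rewrite leqNgt; apply/negP=> /ltnW NK.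
have {HN HK NK} := HN n hk R K NK HK.
set m := d.+2 * d.+2 * (d.+2 * d.+2).
set i0 := Ordinal (ltnW hk); set i1 := Ordinal hk.
case=> X [D1 [D2 [XR XM Xi0 Xi1 XD]]].
have m3 : 2 < m by rewrite /m; nia.
pose o0 : 'I_m := Ordinal (ltnW (ltnW m3)).
pose o1 : 'I_m := Ordinal (ltnW m3); pose o2 : 'I_m := Ordinal m3.
have cmpX e e' (a a' b b' : 'I_m) l : a < a' -> b != b' ->
    (X e a b l < X e' a' b' l, X e' a' b' l < X e a b l) =
    if b < b' then D1.1 l else D2.1 l.
  by move=> aa' bb'; have := XD e e' a a' b b' aa' bb'; case: ifP => _ <-; rewrite ffunE.
have lt_pair (x y : nat) : x < y -> (x < y, y < x) = (true, false).
  by move=> xy; rewrite xy (leq_gtF (ltnW xy)).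
have D1i0 : D1.1 i0 = (true, false).
  by rewrite -(lt_pair _ _ (Xi0 o0 o1 o0 o1 isT)); apply/esym/cmpX.
have D2i0 : D2.1 i0 = (true, false).
  by rewrite -(lt_pair _ _ (Xi0 o0 o1 o1 o0 isT)); apply/esym/cmpX.
have D1i1 : D1.1 i1 = (true, false).
  by rewrite -(lt_pair _ _ (Xi1 o0 o1 o0 o1 isT)); apply/esym/cmpX.
have D2i1 : D2.1 i1 = (false, true).
  have := lt_pair _ _ (Xi1 o1 o0 o0 o1 isT).
  have <- : (X true o0 o1 i1 < X true o1 o0 i1, X true o1 o0 i1 < X true o0 o1 i1) = D2.1 i1.
    exact: cmpX.
  by case=> -> ->.
(* These coordinates are compared by the cell rows alone. *)
pose A := [set l | D1.1 l == D2.1 l].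
have i0A : i0 \in A by rewrite inE D1i0 D2i0.
have i1A : i1 \in ~: A by rewrite !inE D1i1 D2i1.
(* Off [A], reversing the cell columns reverses the comparison: transitivity among five points of a
   3 by 3 array excludes every other pair of distinct types. *)
have swapD l : l \in ~: A -> D1.1 l = ((D2.1 l).2, (D2.1 l).1).
  rewrite !inE; pose v a b : nat := X true a b l.
  have c1 : (v o0 o1 < v o1 o0, v o1 o0 < v o0 o1) = D2.1 l by apply: cmpX.
  have c2 : (v o1 o0 < v o2 o2, v o2 o2 < v o1 o0) = D1.1 l by apply: cmpX.
  have c3 : (v o0 o1 < v o2 o2, v o2 o2 < v o0 o1) = D1.1 l by apply: cmpX.
  have c4 : (v o0 o1 < v o1 o2, v o1 o2 < v o0 o1) = D1.1 l by apply: cmpX.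
  have c5 : (v o0 o1 < v o2 o0, v o2 o0 < v o0 o1) = D2.1 l by apply: cmpX.
  have c6 : (v o1 o2 < v o2 o0, v o2 o0 < v o1 o2) = D2.1 l by apply: cmpX.
  move: c1 c2 c3 c4 c5 c6; clearbody v.
  by case: (D1.1 l) (D2.1 l) => [[] []] [[] []] // [? ?] [? ?] [? ?] [? ?] [? ?] [? ?]; lia.
pose s := @digit_swap (d.+2 * d.+2) : 'I_m -> 'I_m.
have sK : involutive s by exact: digit_swapK.
have s_neq (a b : 'I_m) : a < b -> s a != s b.
  by move=> ab; rewrite (inv_eq sK) sK -val_eqE /= ltn_eqF.
(* [b1] says that the row point precedes the column point in the cell rows, [b2] in the cell
   columns. When [b1] fails the pair is read backwards, which exchanges [D1] with [D2] and the two
   components. *)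
pose e b1 b2 := if b1 then if b2 then (D1.2 A).1 else (D2.2 A).1
                else if b2 then (D2.2 A).2 else (D1.2 A).2.
pose S := [tuple restr A (X true a (s a)) | a < m].
(* This copy of the witnesses gives the permutation the value [~~ e true true]; off it, both copies
   have the same pair types. *)
pose T := [tuple restr (~: A) (X (~~ e true true) (s b) b) | b < m].
have oS : ordered_subset S.
  apply: (@ordered_subset_mktuple _ _ _ _ _ (fun j => D1.1 (val j)) (Sub i0 i0A)).
    move=> a b j ab; rewrite !ffunE cmpX ?s_neq //.
    by case: ifP => // _; have := valP j; rewrite inE => /eqP.
  exact: D1i0.
have oT : ordered_subset T.
  apply: (@ordered_subset_mktuple _ _ _ _ _ (fun j => D1.1 (val j)) (Sub i1 i1A)).
    move=> a b j ab; rewrite !ffunE.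
    have := s_neq a b ab; rewrite -val_eqE neq_ltn => /orP[sab | sba].
      by rewrite cmpX ?ab // -val_eqE /= ltn_eqF.
    (* Cell rows and cell columns are ordered oppositely here; off [A], [D2] read backwards is
       [D1]. *)
    have ba : b != a by rewrite -val_eqE gtn_eqF.
    have := cmpX (~~ e true true) (~~ e true true) _ _ _ _ (val j) sba ba.
    by rewrite (leq_gtF (ltnW ab)) (swapD _ (valP j)) => <-.
  exact: D1i1.
have : grid_rank_atleast (projected_grid R S T) d.+2.
  apply: (@digit_swap_grid_rank _ _ e) => // a; last move=> b.
    rewrite /projected_grid !tnth_mktuple [s (digit_swap a)](sK a) -[digit_swap a]/(s a).
    case: (e true true) => /=.
      (* A joined tuple in [R] would take [i0] from the row point and [i1] from the column point,
         and so project to the non-edge. *)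
      apply: contraNF (XM a (s a)) => /existsP[f /and3P[fR /eqP fA /eqP fB]].
      apply/existsP; exists f; rewrite fR /=.
      have := congr1 (fun g : point n A => g (Sub i0 i0A)) fA.
      have := congr1 (fun g : point n (~: A) => g (Sub i1 i1A)) fB.
      by rewrite !ffunE /= => -> ->; rewrite !eqxx.
    by apply/existsP; exists (X true a (s a)); rewrite XR !eqxx.
  move=> ba; rewrite /projected_grid !tnth_mktuple -/(s a) -/(s b).
  set f := X _ _ b.
  have ab : s a != b by rewrite eq_sym.
  have sab : a != s b by rewrite -(inv_eq sK).
  have := sab; rewrite -val_eqE neq_ltn => /orP[lt_a | gt_a].
    have := XD true (~~ e true true) _ _ _ _ lt_a ab; rewrite lt_a /e -/f.
    by case: ifP => _ <-; rewrite ffunE.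
  have := XD (~~ e true true) true _ _ _ _ gt_a ba; rewrite (leq_gtF (ltnW gt_a)) /e -/f.
  have := ab; rewrite -val_eqE neq_ltn => /orP[lt_b | gt_b].
    by rewrite lt_b (leq_gtF (ltnW lt_b)) => <-; rewrite ffunE.
  by rewrite gt_b (leq_gtF (ltnW gt_b)) => <-; rewrite ffunE.
move/(proj1 (grid_rank_leP _ _) (Rd _ _ _ _ _ oS oT)).
by rewrite ltnNge leqnSn.
Qed.
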